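(* Let $i\in\mathcal N$ and suppose that $(\beta,\alpha_1)$ and $(\beta,\alpha_2)$ are $i$-conjugate and that $C(i,\beta,\alpha_1)$ and $C(i,\beta,\alpha_2)$ are well defined. Then $$h_\beta=C(i,\beta,\alpha_2)\,[(\beta,\alpha_1),\cdot]-C(i,\beta,\alpha_1)\,[(\beta,\alpha_2),\cdot]$$ is $Y$-harmonic on $\partial_i$.
   Context: Let $d\ge 2$, $\mathcal N_0=\{0,1,\dots,d\}$, $\mathcal N_+=\{1,\dots,d\}$, $\mathcal N=\{2,\dots,d\}$; $e_1,\dots,e_d$ are the unit vectors of $\mathbb{Z}^d$, $e_0=0$. Let $p=(p(j,k))_{j,k\in\mathcal N_0}$ be a nonnegative matrix with zero diagonal and entries summing to $1$, irreducible (the directed graph with edges $j\to k$ whenever $p(j,k)>0$ is strongly connected). Put $\mu_j=\sum_{k\in\mathcal N_0}p(j,k)$. Stability is assumed: if $\nu$ is the unique solution of $\nu_j=p(0,j)+\sum_{k\in\mathcal N_+}\nu_kp(k,j)/\mu_k$, $j\in\mathcal N_+$, then $\nu_j<\mu_j$ for all $j\in\mathcal N_+$. Let $\mathcal I$ be the map on $\mathbb{Z}^d$ reversing the sign of the first coordinate, $\mathcal V=\{\mathcal I(e_k-e_j):p(j,k)>0\}$, and $p(v)=p(j,k)$ for $v=\mathcal I(e_k-e_j)$. $Y$ is the Markov chain on $\Omega_Y=\mathbb{Z}\times\mathbb{Z}_+^{d-1}$ with i.i.d. increments $J_k$ with law $P(J_k=v)=p(v)$, $v\in\mathcal V$, where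 the increment is replaced by $0$ whenever it would take $Y$ out of $\Omega_Y$. For $a\subset\mathcal N$, $\partial_a=\{z\in\mathbb{Z}^d:z(j)=0\ \forall j\in a\}$, $\partial_i=\partial_{\{i\}}$, and $\mathcal V_a=\{v\in\mathcal V:v(j)\ne-1\ \forall j\in a\}$. A function $V:\mathbb{Z}^d\to\mathbb{C}$ is called $Y$-harmonic on $\partial_a$ if $V(z)=V(z)\sum_{j\in a}\mu_j+\sum_{v\in\mathcal V_a}V(z+v)p(v)$ for all $z\in\partial_a\cap\Omega_Y$. For $\beta\in\mathbb{C}\setminus\{0\}$, $\alpha=(\alpha(2),\dots,\alpha(d))\in(\mathbb{C}\setminus\{0\})^{\mathcal N}$ and $z\in\mathbb{Z}^d$, $[(\beta,\alpha),z]=\beta^{z(1)-\sum_{j\in\mathcal N}z(j)}\prod_{j\in\mathcal N}\alpha(j)^{z(j)}$. $\mathcal H$ is the set of $(\beta,\alpha)$ (with nonzero entries) such that $\sum_{v\in\mathcal V}p(v)[(\beta,\alpha),v]=1$. For $j\in\mathcal N$, $C(j,\beta,\alpha)=\mu_j-\sum_{v\in\mathcal V,\,v(j)=-1}p(v)[(\beta,\alpha),v]$. For $\alpha$ and $i\in\mathcal N$, $\alpha\{i\}$ is $\alpha$ with its $i$-th entry replaced by $1$. Two distinct points $(\beta,\alpha_1),(\beta,\alpha_2)\in\mathcal H$ are $i$-conjugate if $\alpha_1(j)=\alpha_2(j)$ for all $j\in\mathcal N\setminus\{i\}$ and $$\alpha_2(i)=\frac1{\alpha_1(i)}\,\frac{\sum_{v\in\mathcal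 V,\,v(i)=-1}p(v)[(\beta,\alpha_1\{i\}),v]}{\sum_{v\in\mathcal V,\,v(i)=1}p(v)[(\beta,\alpha_1\{i\}),v]}$$ (with nonzero denominator). *)

(* Defs.v *)
From mathcomp Require Import all_boot all_order all_algebra.
From mathcomp Require Import reals complex.

Set Implicit Arguments.
Unset Strict Implicit.
Unset Printing Implicit Defensive.

Import Order.TTheory GRing.Theory Num.Theory.
Local Open Scope ring_scope.
Local Open Scope complex_scope.

(* The index sets N_0 = {0, ..., d}, N_+ = {1, ..., d} and N = {2, ..., d}.
   Indices are not shifted: the value of j is the index used on paper. *)
Notation node d := 'I_d.+1.
Notation pnode d := {j : 'I_d.+1 | (0 < j)%N}.
Notation inode d := {j : 'I_d.+1 | (1 < j)%N}.

(* Z^d, with coordinates z(1), ..., z(d). *)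
Notation lattice d := {ffun pnode d -> int}.

(* The inclusion of N in N_+. *)
Definition inode_pnode (d : nat) (j : inode d) : pnode d :=
  exist _ (sval j) (ltnW (svalP j)).

Lemma one_node_subproof (d : nat) (hd : (2 <= d)%N) :
  (0 < (inord 1 : 'I_d.+1))%N.
Proof. by rewrite inordK // ltnS ltnW. Qed.

(* The element 1 of N_+. *)
Definition one_node (d : nat) (hd : (2 <= d)%N) : pnode d :=
  exist _ (inord 1) (one_node_subproof hd).

Definition mu (R : realType) (d : nat) (p : 'M[R]_d.+1) (j : node d) : R :=
  \sum_(k : node d) p j k.

Definition irreducible (R : realType) (d : nat) (p : 'M[R]_d.+1) : Prop :=
  forall j k : node d, connect (fun a b => 0 < p a b) j k.

Definition traffic_solution (R : realType) (d : nat) (p : 'M[R]_d.+1)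
    (nu : pnode d -> R) : Prop :=
  forall j : pnode d,
    nu j = p ord0 (sval j)
           + \sum_(k : pnode d) nu k * p (sval k) (sval j) / mu p (sval k).

(* Irreducibility makes the solution of the traffic equation exist and be
   unique, so quantifying over all solutions picks out that one. *)
Definition stable (R : realType) (d : nat) (p : 'M[R]_d.+1) : Prop :=
  forall nu : pnode d -> R, traffic_solution p nu ->
  forall j : pnode d, nu j < mu p (sval j).

(* e_j, with e_0 = 0. *)
Definition unit_vec (d : nat) (j : node d) : lattice d :=
  [ffun k : pnode d => ((sval k == j)%:R : int)].

Definition refl1 (d : nat) (z : lattice d) : lattice d :=
  [ffun k : pnode d => if (sval k : nat) == 1%N then - z k else z k].

Definition jump (d : nat) (j k : node d) : lattice d :=
  refl1 (unit_vec k - unit_vec j).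

(* The finite set V, as a duplicate-free sequence. *)
Definition jumps (R : realType) (d : nat) (p : 'M[R]_d.+1) : seq (lattice d) :=
  undup [seq jump jk.1 jk.2 | jk <- enum {: node d * node d} & 0 < p jk.1 jk.2].

(* p(v).  When p has zero diagonal this sum has at most one nonzero term:
   see jump_probE. *)
Definition jump_prob (R : realType) (d : nat) (p : 'M[R]_d.+1)
    (v : lattice d) : R :=
  \sum_(jk : node d * node d | jump jk.1 jk.2 == v) p jk.1 jk.2.

Lemma mem_jumps (R : realType) (d : nat) (p : 'M[R]_d.+1) (v : lattice d) :
  reflect (exists j k, 0 < p j k /\ v = jump j k) (v \in jumps p).
Proof.
rewrite mem_undup; apply: (iffP mapP) => [[[j k]]|[j [k [pjk ->]]]].
  by rewrite mem_filter /= => /andP[pjk _] ->; exists j, k.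
by exists (j, k) => //; rewrite mem_filter /= pjk mem_enum.
Qed.

Lemma unit_vec_inj (d : nat) : injective (@unit_vec d).
Proof.
move=> j k /ffunP e; case: (posnP j) => [j0|jpos].
  case: (posnP k) => [k0|kpos]; first by apply: val_inj; rewrite /= j0 k0.
  have := e (exist _ k kpos); rewrite !ffunE /= eqxx.
  by case: eqVneq.
have := e (exist _ j jpos); rewrite !ffunE /= eqxx.
by case: eqVneq.
Qed.

Lemma jump_inj (d : nat) (j k j' k' : node d) :
  j != k -> jump j k = jump j' k' -> j = j' /\ k = k'.
Proof.
move=> jk /ffunP e.
have {}e (m : pnode d) : (sval m == k)%:R - (sval m == j)%:R
    = (sval m == k')%:R - (sval m == j')%:R :> int.
  have := e m; rewrite !ffunE.
  by case: ifP => // _ /oppr_inj.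
have aux (a b a' b' : node d) : a != b ->
    (forall m : pnode d, (sval m == b)%:R - (sval m == a)%:R
      = (sval m == b')%:R - (sval m == a')%:R :> int) ->
    (0 < b)%N -> b' = b.
  move=> ab h bpos; have := h (exist _ b bpos); rewrite /= eqxx.
  rewrite (negbTE (_ : b != a)) 1?eq_sym //.
  by case: (eqVneq b b') => // _; case: (b == a').
have auxN (m : pnode d) : (sval m == j)%:R - (sval m == k)%:R
    = (sval m == j')%:R - (sval m == k')%:R :> int.
  by rewrite -opprB e opprB.
have zero (a b : node d) : a = 0%N :> nat -> b = 0%N :> nat -> a = b.
  by move=> a0 b0; apply: val_inj; rewrite /= a0 b0.
have kj : k != j by rewrite eq_sym.
case: (posnP k) => [k0|kpos].
  have jpos : (0 < j)%N.
    by rewrite lt0n; apply: contra jk => /eqP j0; apply/eqP; apply: zero.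
  have ej := aux _ _ _ _ kj auxN jpos; split=> //.
  case: (posnP k') => [k'0|k'pos]; first exact: zero.
  have := e (exist _ k' k'pos); rewrite /= eqxx ej.
  case: (eqVneq k' k) => [->//|_].
  by case: (k' == j).
have ek := aux _ _ _ _ jk e kpos; split=> //.
case: (posnP j) => [j0|jpos]; last by rewrite (aux _ _ _ _ kj auxN jpos).
case: (posnP j') => [j'0|j'pos]; first exact: zero.
have := e (exist _ j' j'pos); rewrite /= eqxx ek.
case: (eqVneq j' j) => [->//|_].
by case: (j' == k).
Qed.

Lemma jump_probE (R : realType) (d : nat) (p : 'M[R]_d.+1) (j k : node d) :
  (forall m, p m m = 0) -> j != k -> jump_prob p (jump j k) = p j k.
Proof.
move=> p0 jk; rewrite /jump_prob (bigD1 (j, k)) //= big1 ?addr0 // => -[a b] /=.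
case/andP=> /eqP e ne; case: (jump_inj jk (esym e)) => ea eb.
by rewrite ea eb eqxx in ne.
Qed.

Definition OmegaY (d : nat) (z : lattice d) : Prop :=
  forall j : inode d, 0 <= z (inode_pnode j).

Definition boundary (d : nat) (a : {set inode d}) (z : lattice d) : Prop :=
  forall j, j \in a -> z (inode_pnode j) = 0.

(* Membership in V_a, for v in V. *)
Definition allowed (d : nat) (a : {set inode d}) (v : lattice d) : bool :=
  [forall j in a, v (inode_pnode j) != -1].

Definition Y_harmonic_on (R : realType) (d : nat) (p : 'M[R]_d.+1)
    (a : {set inode d}) (V : lattice d -> R[i]) : Prop :=
  forall z : lattice d, boundary a z -> OmegaY z ->
    V z = V z * (\sum_(j in a) mu p (sval j))%:C
          + \sum_(v <- jumps p | allowed a v) V (z + v) * (jump_prob p v)%:C.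

(* [(beta, alpha), z]; exponents are integers, possibly negative. *)
Definition monomial (R : realType) (d : nat) (hd : (2 <= d)%N)
    (beta : R[i]) (alpha : {ffun inode d -> R[i]}) (z : lattice d) : R[i] :=
  beta ^ (z (one_node hd) - \sum_(j : inode d) z (inode_pnode j))
  * \prod_(j : inode d) alpha j ^ z (inode_pnode j).

(* The domain on which all the monomials, hence also the functions C(j, ., .),
   are well defined. *)
Definition nonzero_entries (R : realType) (d : nat)
    (beta : R[i]) (alpha : {ffun inode d -> R[i]}) : Prop :=
  beta != 0 /\ forall j, alpha j != 0.

Definition char_surface (R : realType) (d : nat) (hd : (2 <= d)%N)
    (p : 'M[R]_d.+1) (beta : R[i]) (alpha : {ffun inode d -> R[i]}) : Prop :=
  nonzero_entries beta alpha /\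
  \sum_(v <- jumps p) (jump_prob p v)%:C * monomial hd beta alpha v = 1.

(* The sum of p(v) [(beta, alpha), v] over the v in V with v(i) = c. *)
Definition level_sum (R : realType) (d : nat) (hd : (2 <= d)%N)
    (p : 'M[R]_d.+1) (i : inode d) (c : int)
    (beta : R[i]) (alpha : {ffun inode d -> R[i]}) : R[i] :=
  \sum_(v <- jumps p | v (inode_pnode i) == c)
    (jump_prob p v)%:C * monomial hd beta alpha v.

Definition Cfun (R : realType) (d : nat) (hd : (2 <= d)%N)
    (p : 'M[R]_d.+1) (j : inode d)
    (beta : R[i]) (alpha : {ffun inode d -> R[i]}) : R[i] :=
  (mu p (sval j))%:C - level_sum hd p j (-1) beta alpha.

(* alpha{i} *)
Definition set_one (R : realType) (d : nat) (i : inode d)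
    (alpha : {ffun inode d -> R[i]}) : {ffun inode d -> R[i]} :=
  [ffun j => if j == i then 1 else alpha j].

Definition conjugate (R : realType) (d : nat) (hd : (2 <= d)%N)
    (p : 'M[R]_d.+1) (i : inode d)
    (beta : R[i]) (alpha1 alpha2 : {ffun inode d -> R[i]}) : Prop :=
  [/\ char_surface hd p beta alpha1 /\ char_surface hd p beta alpha2,
      alpha1 <> alpha2,
      forall j, j != i -> alpha1 j = alpha2 j,
      level_sum hd p i 1 beta (set_one i alpha1) != 0 &
      alpha2 i = (alpha1 i)^-1
                 * (level_sum hd p i (-1) beta (set_one i alpha1)
                    / level_sum hd p i 1 beta (set_one i alpha1))].

(* Main.v *)
Require Import Defs.
From mathcomp Require Import all_boot all_order all_algebra.
From mathcomp Require Import reals complex.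
From mathcomp Require Import ring.
Import Order.TTheory GRing.Theory Num.Theory.
Local Open Scope ring_scope.
Local Open Scope complex_scope.

(** A monomial [(beta, alpha), .] at a point of the characteristic surface is
    harmonic for the unconstrained walk.  Suppressing the jumps that decrease
    the i-th coordinate, and holding the walk still with weight mu_i instead,
    breaks harmonicity by exactly C(i, beta, alpha) times the monomial itself
    ([monomial_defect]).  On the boundary component where the i-th coordinate
    vanishes, the monomials of two i-conjugate points coincide, since they
    differ only in the base raised to that coordinate
    ([monomial_eq_boundary]).  If M is their common value at z, the defect at z
    of the combination with crossed coefficients C(i, beta, alpha2) and
    -C(i, beta, alpha1) is
      C(i, beta, alpha2) C(i, beta, alpha1) M
        - C(i, beta, alpha1) C(i, beta, alpha2) M = 0. *)

Lemma monomialD (R : realType) (d : nat) (hd : (2 <= d)%N) (beta : R[i])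
    (alpha : {ffun inode d -> R[i]}) (z v : lattice d) :
  nonzero_entries beta alpha ->
  monomial hd beta alpha (z + v)
    = monomial hd beta alpha z * monomial hd beta alpha v.
Proof.
move=> [beta0 alpha0]; rewrite /monomial mulrACA -big_split /=.
congr (_ * _); last first.
  by apply: eq_bigr => j _; rewrite ffunE expfzDr.
rewrite -expfzDr //; congr (_ ^ _).
under eq_bigr => j _ do rewrite ffunE.
by rewrite ffunE big_split /= opprD addrACA.
Qed.

Lemma monomial_eq_boundary (R : realType) (d : nat) (hd : (2 <= d)%N)
    (i : inode d) (beta : R[i]) (alpha1 alpha2 : {ffun inode d -> R[i]})
    (z : lattice d) :
  (forall j, j != i -> alpha1 j = alpha2 j) -> boundary [set i] z ->
  monomial hd beta alpha1 z = monomial hd beta alpha2 z.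
Proof.
move=> alphaE zi; congr (_ * _); apply: eq_bigr => j _.
by have [->|/alphaE->//] := eqVneq j i; rewrite zi ?set11 // !expr0z.
Qed.

Lemma allowed_set1 (d : nat) (i : inode d) (v : lattice d) :
  allowed [set i] v = (v (inode_pnode i) != -1).
Proof.
apply/forall_inP/idP => [|vi j /set1P->//].
by apply; rewrite set11.
Qed.

(** Since monomials are multiplicative, the value at z factors out; what is
    left is the weight of the jumps that remain allowed, namely 1 minus the
    [level_sum] at -1, because the full characteristic sum is 1. *)
Lemma monomial_defect (R : realType) (d : nat) (hd : (2 <= d)%N)
    (p : 'M[R]_d.+1) (i : inode d) (beta : R[i])
    (alpha : {ffun inode d -> R[i]}) (z : lattice d) :
  char_surface hd p beta alpha ->
  \sum_(v <- jumps p | allowed [set i] v)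
     monomial hd beta alpha (z + v) * (jump_prob p v)%:C
  = monomial hd beta alpha z * (1 + Cfun hd p i beta alpha)
    - monomial hd beta alpha z * (mu p (sval i))%:C.
Proof.
move=> [nz sum1]; under eq_bigr => v _ do rewrite monomialD // -mulrA.
rewrite -mulr_sumr -mulrBr; congr (_ * _).
under eq_bigl => v do rewrite allowed_set1.
under eq_bigr => v _ do rewrite mulrC.
rewrite -{}sum1 [in RHS](bigID (fun v : lattice d => v (inode_pnode i) == -1)) /=.
rewrite /Cfun /level_sum.
by ring.
Qed.

Theorem proposition5p1 (R : realType) (d : nat) (hd : (2 <= d)%N)
    (p : 'M[R]_d.+1)
    (p_ge0 : forall j k, 0 <= p j k)
    (p_diag : forall j, p j j = 0)
    (p_sum : \sum_j \sum_k p j k = 1)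
    (p_irr : irreducible p)
    (p_stable : stable p)
    (i : inode d) (beta : R[i]) (alpha1 alpha2 : {ffun inode d -> R[i]})
    (hconj : conjugate hd p i beta alpha1 alpha2)
    (hC1 : nonzero_entries beta alpha1)
    (hC2 : nonzero_entries beta alpha2) :
  Y_harmonic_on p [set i]
    (fun z => Cfun hd p i beta alpha2 * monomial hd beta alpha1 z
              - Cfun hd p i beta alpha1 * monomial hd beta alpha2 z).
Proof.
case: hconj => -[surf1 surf2] _ alphaE _ _ z zi _.
rewrite big_set1.
under eq_bigr => v _ do rewrite mulrBl -mulrA -[X in _ - X]mulrA.
rewrite sumrB -!mulr_sumr !monomial_defect //.
rewrite (monomial_eq_boundary _ _ _ _ _ _ _ _ alphaE zi).
by ring.
Qed.
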